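(* Let $N\ge 2$ be an integer. If $M$ is an integer with $M \geq R_{N-1}-2N+1$, then for all integers $m \geq M$ with $m\ge 3$ and all integers $n$ with $1\le n \leq N$, $$\mathfrak{pr}(C_m+P_n) = \begin{cases} m+2n & \text{if } m \text{ is odd},\\ m+2n-1 & \text{if } m \text{ is even}.\end{cases}$$
   Context: All graphs are finite and simple. A coprime labeling of a graph $G$ is an injection $f\colon V(G)\to\{1,2,\dots,k\}$, for some integer $k\ge |V(G)|$, such that $\gcd(f(u),f(v))=1$ whenever $(u,v)\in E(G)$. The minimum coprime number $\mathfrak{pr}(G)$ is the least $k$ for which such a labeling exists. $P_n$ is the path on $n$ vertices and $C_m$ is the cycle on $m\ge 3$ vertices. The join $G+H$ of two disjoint graphs is the union $G\cup H$ together with all edges between a vertex of $G$ and a vertex of $H$. For $k\ge 1$, the $k$-th Ramanujan prime $R_k$ is the least integer such that $\pi(x)-\pi(x/2)\ge k$ for all $x\ge R_k$, where $\pi(x)$ is the number of primes less than or equal to $x$. *)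

(* Defs.v *)
From mathcomp Require Import all_boot all_order all_algebra reals.

Set Implicit Arguments.
Unset Strict Implicit.
Unset Printing Implicit Defensive.
Import Order.TTheory GRing.Theory Num.Theory.

Record sgraph := SGraph {
  vertex : finType;
  adj : rel vertex;
  adj_sym : symmetric adj;
  adj_irr : irreflexive adj }.

Section CoprimeLabeling.
Variable G : sgraph.

(* The codomain 'I_k.+1 minus 0 is {1, ..., k}; injectivity forces
   #|vertex G| <= k. *)
Definition coprime_labeling k (f : {ffun vertex G -> 'I_k.+1}) : bool :=
  [&& injectiveb f, [forall u, 0 < f u]
    & [forall u, forall v, adj u v ==> (gcdn (f u) (f v) == 1)]].

Definition has_coprime_labeling k : bool :=
  [exists f : {ffun vertex G -> 'I_k.+1}, coprime_labeling f].

(* Label the vertices by distinct primes. *)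
Lemma has_coprime_labeling_ex : exists k, has_coprime_labeling k.
Proof.
have [s [us ss ps]] : exists s : seq nat,
    [/\ uniq s, size s = #|vertex G| & all prime s].
  elim: #|vertex G| => [|n [s [us ss ps]]]; first by exists [::].
  have [p lt_p pr_p] := prime_above (\max_(x <- s) x).
  exists (p :: s); rewrite /= ss us pr_p ps; split=> //; rewrite andbT.
  by apply/negP=> sp; move: lt_p; rewrite ltnNge (@leq_bigmax_seq _ _ xpredT id).
pose g (u : vertex G) := nth 0 s (enum_rank u).
have lt_u (u : vertex G) : enum_rank u < size s by rewrite ss.
have sg u : g u \in s by rewrite mem_nth.
have pg u : prime (g u) by apply: (allP ps).
have g_inj : injective g.
  by move=> u v /eqP; rewrite nth_uniq // => /eqP/val_inj/enum_rank_inj.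
pose k := \max_(x <- s) x.
have gk u : g u < k.+1 by rewrite ltnS (@leq_bigmax_seq _ _ xpredT id).
exists k; apply/existsP; exists [ffun u => Ordinal (gk u)]; apply/and3P; split.
- by apply/injectiveP=> u v; rewrite !ffunE => /(congr1 val)/g_inj.
- by apply/forallP=> u; rewrite ffunE /= prime_gt0.
- apply/forallP=> u; apply/forallP=> v; apply/implyP=> uv; rewrite !ffunE /=.
  rewrite -/(coprime _ _) prime_coprime // dvdn_prime2 //.
  by apply/eqP=> /g_inj eq_uv; rewrite eq_uv adj_irr in uv.
Qed.

Definition min_coprime_number : nat := ex_minn has_coprime_labeling_ex.

End CoprimeLabeling.

Section Path.
Variable n : nat.

Definition path_adj : rel 'I_n := fun i j => (i.+1 == j) || (j.+1 == i).

Lemma path_adj_sym : symmetric path_adj.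
Proof. by move=> i j; rewrite /path_adj orbC. Qed.

Lemma path_adj_irr : irreflexive path_adj.
Proof. by move=> i; rewrite /path_adj orbb; apply/negbTE; rewrite gtn_eqF. Qed.

Definition path_graph := SGraph path_adj_sym path_adj_irr.

End Path.

Section Cycle.
Variable m : nat.

(* The first conjunct is redundant for m >= 3; it excludes the loop that the
   formula would give for m = 1. *)
Definition cycle_adj : rel 'I_m :=
  fun i j => (i != j) && ((i.+1 %% m == j) || (j.+1 %% m == i)).

Lemma cycle_adj_sym : symmetric cycle_adj.
Proof. by move=> i j; rewrite /cycle_adj eq_sym orbC. Qed.

Lemma cycle_adj_irr : irreflexive cycle_adj.
Proof. by move=> i; rewrite /cycle_adj eqxx. Qed.

Definition cycle_graph := SGraph cycle_adj_sym cycle_adj_irr.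

End Cycle.

Section Join.
Variables G H : sgraph.

Definition join_adj : rel (vertex G + vertex H) := fun x y =>
  match x, y with
  | inl u, inl v => adj u v
  | inr u, inr v => adj u v
  | _, _ => true
  end.

Lemma join_adj_sym : symmetric join_adj.
Proof. by move=> [u|u] [v|v] //=; apply: adj_sym. Qed.

Lemma join_adj_irr : irreflexive join_adj.
Proof. by move=> [u|u] /=; apply: adj_irr. Qed.

Definition graph_join := SGraph join_adj_sym join_adj_irr.

End Join.

Local Open Scope ring_scope.

(* A natural number p <= x is at most Num.truncn x, so the index type misses
   no prime; for x < 0 the condition p%:R <= x makes the set empty. *)
Definition prime_pi (R : realType) (x : R) : nat :=
  #|[set p : 'I_(Num.truncn x).+1 | prime p && (p%:R <= x)]|.

Definition ramanujan_bound (R : realType) (k : nat) (r : int) : Prop :=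
  forall x : R, r%:~R <= x ->
    k%:Z <= (prime_pi x)%:Z - (prime_pi (x / 2))%:Z.

(* r = R_k, the k-th Ramanujan prime; meaningful for k >= 1 only (for k = 0
   there is no least bound). *)
Definition is_ramanujan_prime (R : realType) (k : nat) (r : int) : Prop :=
  ramanujan_bound R k r /\
  forall s : int, ramanujan_bound R k s -> r <= s.

(* Main.v *)
Require Import Defs.
From mathcomp Require Import all_boot all_order all_algebra reals.
From mathcomp Require Import zify.

Import GRing.Theory Num.Theory.

(** Write [k = 2 (uphalf m + n) - 1], an odd number, which is the claimed value
    in both parities of [m].

    Lower bound.  Vertices with even labels are pairwise non-adjacent.  Since
    the two sides of a join are completely connected, they all lie on one side:
    at most [m./2] of them if this side is the cycle, at most [uphalf n] if it
    is the path.  All other vertices carry distinct odd labels, and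
    [{1, ..., j}] contains [uphalf j] odd numbers.  If the even labels are on
    the cycle, this forces [j >= k]; if they are on the path, it forces
    [j >= 2 (m + n./2) - 1], which is at least [k] because [m > 2 uphalf n]
    ([has_coprime_labeling_lower_bound]).

    Upper bound.  The path receives 1 and [n - 1] primes of [(k/2, k]]; such a
    prime is coprime to every other label, as its double exceeds [k].  The
    remaining odd numbers [3 = o_1 < ... < o_h] of [{1, ..., k}] all go on the
    cycle, in increasing order, with an even number in each gap.  Two
    consecutive [o_i] are separated by primes of the path only, and three
    consecutive odd numbers beyond 3 are never all prime, so
    [o_(i+1) - o_i <= 6]; then one of [o_i + 1] and [o_(i+1) - 1] is coprime to
    both ends ([even_betweenP]).  The label 2 closes the cycle.  For odd [m] the
    cycle has one vertex less than this, and 3 and [o_2], which is 5 or 7, are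
    made adjacent ([exists_cycle_labels]).

    Ramanujan primes.  Put [x = k + 2 (N - n)]; the hypothesis on [M] says
    [x >= R_(N-1)], so [(x/2, x]] contains [N - 1] primes.  Decreasing the right
    end by 2 loses at most one prime, which leaves the [n - 1] primes of
    [(k/2, k]] ([size_upper_half_primesD]).  The inequality [m > 2 uphalf n]
    is just [m >= 3] when [n <= 2].  For [N >= 3] it follows from
    [R_K > 3 (K + 1)] with [K = N - 1] ([ramanujan_bound_gt]), which
    holds, apart from small [K] treated separately, because [(2t, 4t]] contains
    only [t] odd numbers, hence at most [t] primes. *)

(** * Primes between x/2 and x *)

Definition upper_half_primes (x : nat) : seq nat :=
  [seq p <- iota x./2.+1 (uphalf x) | prime p].

Lemma mem_upper_half_primes x p :
  (p \in upper_half_primes x) = [&& prime p, x < p.*2 & p <= x].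
Proof. rewrite mem_filter mem_iota; case: (prime p) => //=; lia. Qed.

(** The interval loses its first element and gains two consecutive numbers
    greater than 2, one of which is even. *)
Lemma size_upper_half_primesD2 x : 1 < x ->
  size (upper_half_primes x.+2) <= (size (upper_half_primes x)).+1.
Proof.
move=> x1; rewrite !size_filter.
have -> : x.+2./2.+1 = x./2.+2 by [].
have -> : uphalf x.+2 = (uphalf x).+1 by [].
have h : count prime (iota x./2.+1 (uphalf x).+2)
    = count prime (iota x./2.+1 (uphalf x)) + count prime [:: x.+1; x.+2].
  rewrite -addn2 iotaD count_cat; congr (_ + count _ _).
  by congr [:: _; _]; lia.
apply: leq_trans (leq_addl (prime x./2.+1) _) _.
rewrite -[_ + _]/(count prime (iota x./2.+1 (uphalf x).+2)).
rewrite h -[leqRHS]addn1 leq_add2l /= addn0.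
case: (boolP (prime x.+1)) => // px1; case: (boolP (prime x.+2)) => // px2.
by case: (even_prime px1) => ?; case: (even_prime px2) => ?; lia.
Qed.

Lemma size_upper_half_primesD x d : 1 < x ->
  size (upper_half_primes (x + d.*2)) <= size (upper_half_primes x) + d.
Proof.
move=> x1; elim: d => [|d IH]; first by rewrite !addn0.
rewrite doubleS !addnS; have := @size_upper_half_primesD2 (x + d.*2); lia.
Qed.

Lemma count_odd_iota a t : count odd (iota a t.*2) = t.
Proof.
elim: t a => [|t IH] a; rewrite ?doubleS //= IH.
by case: (odd a); rewrite /= ?add1n ?add0n.
Qed.

(** For [t > 0] the primes of [(2t, 4t]] are odd. *)
Lemma size_upper_half_primes4 t : 0 < t ->
  size (upper_half_primes t.*2.*2) <= t.
Proof.
move=> t0; rewrite size_filter doubleK uphalf_double.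
rewrite -[leqRHS](count_odd_iota t.*2.+1) -!size_filter.
apply: uniq_leq_size; first by rewrite filter_uniq ?iota_uniq.
move=> p; rewrite !mem_filter => /andP[/even_prime[->|->]] //.
by rewrite mem_iota; lia.
Qed.

Lemma prime_piE (R : realType) (y : R) : (0 <= y)%R ->
  prime_pi y = count prime (iota 0 (Num.truncn y).+1).
Proof.
move=> y0; rewrite -sum1_count -[iota _ _]/(index_iota 0 _.+1) big_mkord.
rewrite sum1_card.
apply: eq_card => p; rewrite inE; apply: andb_idr => _.
by rewrite -truncn_ge_nat // -ltnS.
Qed.

Lemma prime_pi_upper_half (R : realType) (x : nat) :
  prime_pi (x%:R : R)%R =
  prime_pi (x%:R / 2 : R)%R + size (upper_half_primes x).
Proof.
have tr2 : Num.truncn (x%:R / 2 : R)%R = x./2.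
  apply: truncn_def; rewrite ler_pdivlMr ?ltr_pdivrMr ?ltr0n //.
  rewrite -!natrM ler_nat ltr_nat; lia.
rewrite !prime_piE ?divr_ge0 ?ler0n // natrK tr2 size_filter.
by rewrite -count_cat -iotaD; congr (count _ (iota _ _)); lia.
Qed.

Lemma ramanujan_bound_nat (R : realType) (K : nat) (r : int) (x : nat) :
  ramanujan_bound R K r -> (r <= x%:Z)%R -> K <= size (upper_half_primes x).
Proof.
move=> hr rx; have := hr (x%:R)%R; rewrite prime_pi_upper_half.
rewrite -(ler_int R) in rx => /(_ rx).
by rewrite PoszD addrAC subrr add0r lez_nat.
Qed.

(** If [r] were at most [3 (K + 1)], the bound could be used at any larger
    [x].  Taking [x = 4 (K - 1)] contradicts [size_upper_half_primes4] as soon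
    as this [x] is at least [3 (K + 1)], that is for [K >= 7].  The intervals
    [(5, 10]], [(8, 16]] and [(14, 28]], with 1, 2 and 3 primes, settle the
    values of [K] below 7. *)
Lemma ramanujan_bound_gt (R : realType) (K : nat) (r : int) :
  1 < K -> ramanujan_bound R K r -> ((3 * K.+1)%:Z < r)%R.
Proof.
move=> K1 hr; rewrite real_ltNge ?num_real //; apply/negP => rle.
have h x : 3 * K.+1 <= x -> K <= size (upper_half_primes x).
  by move=> le; apply: ramanujan_bound_nat hr _; lia.
have [K7 | K7] := leqP 7 K.
  have := h (K.-1).*2.*2; have := @size_upper_half_primes4 K.-1; lia.
clear hr rle; case: K K1 K7 h => [|[|[|[|[|[|[|K]]]]]]] // _ K7 h.
- by have := h 10 isT.
- by have := h 16 isT.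
- by have := h 28 isT.
- by have := h 28 isT.
- by have := h 28 isT.
Qed.

(** * Even labels and the lower bound *)

Definition independent (G : sgraph) (I : {set vertex G}) : Prop :=
  {in I &, forall u v, ~~ adj u v}.

Lemma independent_even_labels (G : sgraph) k (f : {ffun vertex G -> 'I_k.+1}) :
  coprime_labeling f -> independent G [set u | ~~ odd (f u)].
Proof.
case/and3P=> _ _ /forallP fc u v; rewrite !inE => eu ev; apply/negP => uv.
have /eqP g1 := implyP (forallP (fc u) v) uv.
have : 2 %| gcdn (f u) (f v) by rewrite dvdn_gcd !dvdn2 eu.
by rewrite g1.
Qed.

(** Halving is injective on odd labels. *)
Lemma card_odd_labels (G : sgraph) k (f : {ffun vertex G -> 'I_k.+1}) :
  coprime_labeling f -> #|[set u | odd (f u)]| <= uphalf k.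
Proof.
case/and3P=> /injectiveP f_inj _ _.
have fk u : odd (f u) -> (f u)./2 < uphalf k by have := ltn_ord (f u); lia.
case: (posnP (uphalf k)) => [k0|k0].
  rewrite k0 leqn0 cards_eq0; apply/eqP/setP => u; rewrite !inE.
  by apply/negP => /fk; rewrite k0.
rewrite -[leqRHS]card_ord.
apply: (@leq_card_in _ _ (fun u => insubd (Ordinal k0) (f u)./2)) => u v.
rewrite !inE => ou ov /(congr1 val); rewrite !val_insubd !fk // => e.
by apply: f_inj; apply: val_inj => /=; lia.
Qed.

Lemma modnS_ord m (i : 'I_m) : i.+1 %% m = if i.+1 == m then 0 else i.+1.
Proof.
by case: eqP (ltn_ord i) => [->|? ?]; rewrite ?modnn // modn_small //; lia.
Qed.

(** The successor along the cycle maps an independent set injectively into its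
    complement. *)
Lemma independent_cycle m (I : {set 'I_m}) : 1 < m ->
  independent (cycle_graph m) I -> #|I| <= m./2.
Proof.
move=> m1; rewrite /independent /= => indI.
have lt_s (i : 'I_m) : i.+1 %% m < m by rewrite ltn_mod; lia.
pose s i := Ordinal (lt_s i).
have s_inj : injective s.
  move=> i j /(congr1 val) /= e; apply: val_inj => /=.
  have := (ltn_ord i, ltn_ord j) => -[im jm].
  by move: e; rewrite !modnS_ord; do 2!case: eqP; lia.
have sI : s @: I \subset ~: I.
  apply/subsetP => _ /imsetP[i iI ->]; rewrite inE; apply/negP => siI.
  have /negP[] := indI _ _ iI siI; rewrite /cycle_adj /= eqxx andbT.
  apply/eqP => /(congr1 val) /= e; have im := ltn_ord i.
  by move: e; rewrite modnS_ord; case: eqP; lia.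
have le_I : #|I| <= #|~: I|.
  by rewrite -(card_imset (mem I) s_inj); exact: subset_leq_card.
rewrite geq_half_double; apply: (@leq_trans (#|I| + #|~: I|)).
  by rewrite -addnn leq_add2l.
by rewrite cardsC card_ord.
Qed.

(** Each pair of vertices [2j, 2j + 1] of the path contains at most one element
    of an independent set. *)
Lemma independent_path n (I : {set 'I_n}) :
  independent (path_graph n) I -> #|I| <= uphalf n.
Proof.
rewrite /independent /=; case: n I => [|n] I indI.
  by rewrite -[leqRHS](card_ord 0) max_card.
rewrite -[leqRHS]card_ord.
apply: (@leq_card_in _ _ (fun i : 'I_n.+1 => inord i./2 : 'I_(uphalf n.+1))).
move=> i j iI jI /(congr1 val).
have [im jm] := (ltn_ord i, ltn_ord j).
rewrite /= !inordK; try lia; move=> e.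
have := indI _ _ iI jI; rewrite /path_adj => h.
by apply: val_inj => /=; lia.
Qed.

(** Elements of [I] on both sides of the join would be adjacent. *)
Lemma independent_join (G H : sgraph) (I : {set vertex (graph_join G H)}) :
  independent (graph_join G H) I ->
  (exists2 J, independent G J & #|J| = #|I|)
  \/ (exists2 J, independent H J & #|J| = #|I|).
Proof.
rewrite /independent /= => indI.
case: (boolP [exists u, inl u \in I]) => [/existsP[u0 u0I]|/existsPn noI].
- left; exists [set u | inl u \in I].
    by move=> u v; rewrite !inE => uI vI; exact: (indI _ _ uI vI).
  rewrite -(card_imset _ (@inl_inj _ (vertex H))); apply: eq_card => -[u|v].
    by rewrite mem_imset ?inE //; apply: inl_inj.
  apply/imsetP/idP => [[] // | vI].
  by have := indI _ _ u0I vI.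
- right; exists [set v | inr v \in I].
    by move=> u v; rewrite !inE => uI vI; exact: (indI _ _ uI vI).
  rewrite -(card_imset _ (@inr_inj (vertex G) _)); apply: eq_card => -[u|v].
    by rewrite (negbTE (noI u)); apply/imsetP => -[].
  by rewrite mem_imset ?inE //; apply: inr_inj.
Qed.

Lemma has_coprime_labeling_lower_bound m n k :
  1 < m -> (uphalf n).*2 < m ->
  has_coprime_labeling (graph_join (cycle_graph m) (path_graph n)) k ->
  (uphalf m + n).*2.-1 <= k.
Proof.
move=> m1 nm /existsP[f fP].
have odd_f := card_odd_labels _ _ _ fP.
have := cardsC [set u | odd (f u)].
have -> : ~: [set u | odd (f u)] = [set u | ~~ odd (f u)].
  by apply/setP => u; rewrite !inE.
rewrite card_sum !card_ord => cardE.
have := independent_join _ _ _ (independent_even_labels _ _ _ fP).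
move: odd_f cardE.
set a := #|_|; set b := #|_| => odd_f cardE.
case=> -[J indJ cardJ].
- have := independent_cycle _ _ m1 indJ; rewrite cardJ; lia.
- have := independent_path _ _ indJ; rewrite cardJ; lia.
Qed.

(** * Labelings given by lists *)

Lemma nth_cycle (T : Type) (e : rel T) x0 (s : seq T) i :
  cycle e s -> i < size s -> e (nth x0 s i) (nth x0 s (i.+1 %% size s)).
Proof.
case: s => // x s /= /(pathP x0) /(_ i); rewrite size_rcons => h lt_i.
move: (h lt_i); rewrite nth_rcons -rcons_cons nth_rcons /= lt_i.
rewrite (modnS_ord _ (Ordinal lt_i)) /= eqSS.
have [->|ne] := eqVneq i (size s); first by rewrite ltnn.
by have -> : i < size s by lia.
Qed.

Lemma has_coprime_labeling_join (s t : seq nat) k :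
  uniq (s ++ t) -> all (fun x => 0 < x <= k) (s ++ t) ->
  cycle coprime s -> sorted coprime t -> allrel coprime s t ->
  has_coprime_labeling
    (graph_join (cycle_graph (size s)) (path_graph (size t))) k.
Proof.
move=> Ust /allP st_k s_cyc t_path st.
pose g (w : 'I_(size s) + 'I_(size t)) :=
  match w with inl i => nth 0 s i | inr j => nth 0 t j end.
pose idx (w : 'I_(size s) + 'I_(size t)) : nat :=
  match w with inl i => i | inr j => size s + j end.
have gE w : g w = nth 0 (s ++ t) (idx w).
  by case: w => i; rewrite nth_cat ?ltn_ord //= ltnNge leq_addr addKn.
have g_in w : g w \in s ++ t.
  by case: w => i; rewrite mem_cat /= mem_nth ?orbT.
have g_inj : injective g.
  have lt_idx w : idx w < size (s ++ t).
    by rewrite size_cat; case: w => i /=; have := ltn_ord i; lia.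
  move=> u v /eqP; rewrite !gE nth_uniq // => /eqP.
  case: u v => i [] j /=; have := ltn_ord i; have := ltn_ord j.
  - by move=> _ _ /val_inj->.
  - by lia.
  - by lia.
  - by move=> _ _ /addnI/val_inj->.
have g_lt w : g w < k.+1 by have := st_k _ (g_in w); lia.
apply/existsP; exists [ffun w => Ordinal (g_lt w)]; apply/and3P; split.
- by apply/injectiveP => u v; rewrite !ffunE => /(congr1 val)/g_inj.
- by apply/forallP => u; rewrite ffunE /=; have := st_k _ (g_in u); lia.
apply/forallP => u; apply/forallP => v; apply/implyP; rewrite !ffunE /=.
rewrite -/(coprime _ _); case: u v => i [] j /=.
- case/andP=> _ /orP[]/eqP <-; last rewrite coprime_sym; exact: nth_cycle.
- by move=> _; apply: (allrelP st); apply: mem_nth.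
- by move=> _; rewrite coprime_sym; apply: (allrelP st); apply: mem_nth.
- by case/orP=> /eqP e; last rewrite coprime_sym; rewrite -e;
    apply: (sortedP 0 t_path); rewrite e.
Qed.

(** * Alternating odd and even labels *)

Definition prime_gap (a b : nat) : Prop :=
  forall x, odd x -> a < x < b -> prime x.

(** Intended for odd [a] and [b] with [b - a] equal to 2, 4 or 6: then [a + 1]
    and [b] differ by 1, 3 or 5, and so do [a] and [b - 1]. *)
Definition even_between (a b : nat) : nat :=
  if coprime a.+1 b then a.+1 else b.-1.

Lemma coprime_addr_prime x p : prime p -> coprime x (x + p) = ~~ (p %| x).
Proof.
move=> pp; rewrite /coprime gcdnDl -/(coprime x p) coprime_sym.
exact: prime_coprime.
Qed.

(** The gap is at most 6, since one of [a + 2], [a + 4], [a + 6] is a multiple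
    of 3.  In a gap of 4, if [a + 1] fails then 3 divides [a + 1], hence not
    [a], and [a + 3] works; in a gap of 6, likewise with 5 and [a + 5]. *)
Lemma even_betweenP a b : odd a -> odd b -> 2 < a < b -> prime_gap a b ->
  [/\ a < even_between a b < b, ~~ odd (even_between a b),
      coprime a (even_between a b) & coprime (even_between a b) b].
Proof.
move=> oa ob /andP[a2 ab] pr.
have ndvd3 x : odd x -> a < x < b -> ~~ (3 %| x).
  move=> ox axb; apply/negP => x3; have px := pr _ ox axb.
  by have := x3; rewrite dvdn_prime2 // => /eqP; lia.
have b6 : b <= a + 6.
  rewrite leqNgt; apply/negP => lt_b.
  have := (ndvd3 (a + 2), ndvd3 (a + 4), ndvd3 (a + 6)).
  rewrite !oddD oa /=; case => [[h2 h4] h6].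
  by move: (h2 isT) (h4 isT) (h6 isT); lia.
have {}b6 : [\/ b = a + 2, b = a + 4 | b = a + 6].
  have : [|| b == a + 2, b == a + 4 | b == a + 6] by lia.
  by case/or3P=> /eqP; [constructor 1 | constructor 2 | constructor 3].
rewrite /even_between; case: ifP => [cop_b | /negbT ncop_b].
  by rewrite coprimenS; split=> //=; lia.
have b0 : 0 < b by lia.
have cop_pred : coprime b.-1 b by rewrite -{2}(prednK b0) coprimenS.
suff -> : coprime a b.-1 by split=> //; lia.
case: b6 => b_eq; move: ncop_b; rewrite b_eq.
- by rewrite addn2 coprimenS.
- rewrite (_ : a + 4 = a.+1 + 3); last by lia.
  rewrite (_ : (a.+1 + 3).-1 = a + 3); last by lia.
  rewrite !coprime_addr_prime //; lia.
- rewrite (_ : a + 6 = a.+1 + 5); last by lia.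
  rewrite (_ : (a.+1 + 5).-1 = a + 5); last by lia.
  rewrite !coprime_addr_prime //; lia.
Qed.

Fixpoint weave (a : nat) (s : seq nat) : seq nat :=
  if s is b :: s' then even_between a b :: b :: weave b s' else [::].

Lemma size_weave a s : size (weave a s) = (size s).*2.
Proof. by elim: s a => //= b s IH a; rewrite IH. Qed.

Lemma last_weave a s : last a (weave a s) = last a s.
Proof. by elim: s a => //= b s IH a; rewrite IH. Qed.

(** Being increasing, the list has distinct entries.  The last conclusion keeps
    its entries within the range of the labels and away from the odd labels
    used elsewhere. *)
Lemma path_weave a s :
  2 < a -> all odd (a :: s) -> path ltn a s ->
  (forall i, i < size s ->
     prime_gap (nth 0 (a :: s) i) (nth 0 (a :: s) i.+1)) ->
  [/\ path ltn a (weave a s), path coprime a (weave a s)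
    & {in weave a s, forall x, (odd x -> x \in s) /\ has (leq x) s}].
Proof.
elim: s a => [|b s IH] a a2 //= /and3P[oa ob os] /andP[ab bs] gap.
have [] := IH b (ltn_trans a2 ab).
- by rewrite /= ob os.
- exact: bs.
- by move=> i lt_i; exact: (gap i.+1 lt_i).
move=> lt_w cop_w odd_w.
have a2b : 2 < a < b by rewrite a2.
have [/andP[lt_ae lt_eb] even_e cop_ae cop_eb] :=
  even_betweenP a b oa ob a2b (gap 0 isT).
rewrite lt_ae lt_eb cop_ae cop_eb lt_w cop_w; split=> // x.
rewrite !inE => /or3P[/eqP->|/eqP->|/odd_w[odd_x ->]].
- by rewrite (negbTE even_e) (ltnW lt_eb).
- by rewrite eqxx leqnn.
- by rewrite orbT; split=> // /odd_x ->; rewrite orbT.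
Qed.

Lemma sorted_nth_gap (s : seq nat) i x : sorted ltn s -> i.+1 < size s ->
  nth 0 s i < x < nth 0 s i.+1 -> x \notin s.
Proof.
move=> ss lt_i /andP[ix xi]; apply/negP => /(nthP 0)[j lt_j xE].
have lt_nth := sorted_ltn_nth ltn_trans 0 ss.
have [ji|ij|ji] := ltngtP j i.
- have : nth 0 s j < nth 0 s i := lt_nth j i lt_j (ltnW lt_i) ji.
  by rewrite xE ltnNge (ltnW ix).
- have [ji|ji|ji] := ltngtP j i.+1; first by lia.
    have : nth 0 s i.+1 < nth 0 s j := lt_nth i.+1 j lt_i lt_j ji.
    by rewrite xE ltnNge (ltnW xi).
  by move: xi; rewrite -xE ji ltnn.
by move: ix; rewrite -xE ji ltnn.
Qed.

(** The odd labels which remain for the cycle when the labels of the path are 1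
    and [L], and the largest label is [2h + 1]. *)
Definition odds_without (L : seq nat) (h : nat) : seq nat :=
  [seq x <- [seq i.*2.+1 | i <- iota 1 h] | x \notin L].

Lemma mem_odds_without L h x :
  (x \in odds_without L h) = [&& odd x, 2 < x <= h.*2.+1 & x \notin L].
Proof.
rewrite mem_filter andbC andbA; congr (_ && _).
apply/mapP/andP => [[i]|[ox hx]]; first by rewrite mem_iota => ? ->; lia.
by exists x./2; rewrite ?mem_iota; lia.
Qed.

Lemma sorted_odds_without L h : sorted ltn (odds_without L h).
Proof.
apply: sorted_filter; first exact: ltn_trans.
rewrite sorted_map; apply: sub_sorted (iota_ltn_sorted 1 h) => i j /=; lia.
Qed.

Lemma size_odds_without L h : uniq L ->
  {in L, forall p, odd p && (2 < p <= h.*2.+1)} ->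
  size (odds_without L h) = h - size L.
Proof.
move=> uL L_odd; rewrite size_filter.
set A := map _ _; have <- : size A = h by rewrite size_map size_iota.
rewrite -(count_predC (mem L) A).
suff -> : count (mem L) A = size L by rewrite addKn.
rewrite -size_filter; apply/perm_size/uniq_perm => //.
  by rewrite filter_uniq // map_inj_uniq ?iota_uniq // => i j; lia.
move=> x; rewrite mem_filter; apply: andb_idr => /L_odd /andP[ox hx].
by apply/mapP; exists x./2; rewrite ?mem_iota; lia.
Qed.

(** The labels of the cycle other than 2 and 3, in the order in which they
    follow 3.  For even [m] every gap between odd labels receives an even label;
    for odd [m] the first gap receives none, which requires [o_2] to be coprime
    to 3: as 5 and 7 are not both in [L], [o_2] is 5 or 7. *)
Lemma exists_cycle_labels L h m : 2 < m -> {in L, forall p, prime p} ->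
  3 \notin L -> ~~ ((5 \in L) && (7 \in L)) ->
  size (odds_without L h) = uphalf m ->
  exists w, [/\ size w = m - 2, path ltn 3 w, path coprime 3 w,
    {in w, forall x, (odd x -> x \in odds_without L h)
                     /\ has (leq x) (odds_without L h)}
    & odd (last 3 w)].
Proof.
move=> m2 prL L3 L57; set O := odds_without L h => szO; pose k := h.*2.+1.
have O_gt x : x \in O -> [/\ odd x, 2 < x <= k & x \notin L].
  by rewrite mem_odds_without => /and3P.
have notL x : odd x -> 2 < x <= k -> x \notin O -> x \in L.
  by rewrite mem_odds_without => -> -> /=; rewrite negbK.
have O3 : 3 \in O.
  rewrite mem_odds_without L3 andbT /=.
  by move: szO; rewrite /O; case: (h) => [|h'] /=; lia.
have ltO := sorted_odds_without L h; rewrite -/O in ltO.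
have gapO i : i.+1 < size O -> prime_gap (nth 0 O i) (nth 0 O i.+1).
  move=> i1 x ox hx.
  have [_ /andP[_ le_k] _] := O_gt _ (mem_nth 0 i1).
  have [_ /andP[gt2 _] _] := O_gt _ (mem_nth 0 (ltnW i1)).
  have xL : x \in L.
    apply: notL ox _ (sorted_nth_gap O i x ltO i1 hx).
    case/andP: hx => ix xi.
    by rewrite (ltn_trans gt2 ix) (leq_trans (ltnW xi) le_k).
  exact: prL.
have [s OE] : exists s, O = 3 :: s.
  case: (O) ltO O3 O_gt => // a s /= a_s; rewrite inE => /predU1P[<-|s3] agt.
    by exists s.
  have a3 : a < 3 := allP (order_path_min ltn_trans a_s) 3 s3.
  by have [_ ? _] := agt a (mem_head _ _); lia.
have oddO : all odd O by apply/allP => x /O_gt[].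
have ss : path ltn 3 s by move: ltO; rewrite OE.
have [odd_m | even_m] := boolP (odd m); last first.
  have [//|||i lt_i|ltw copw wO] := path_weave 3 s.
  - by rewrite -OE.
  - exact: ss.
  - by rewrite -OE; apply: gapO; rewrite OE.
  exists (weave 3 s); split=> //.
  - by move: szO; rewrite size_weave OE /=; lia.
  - move=> x /wO[xs hs]; rewrite OE inE /= hs orbT; split=> // /xs->.
    by rewrite orbT.
  - by rewrite last_weave; apply: (allP oddO); rewrite OE mem_last.
case: s OE ss => [|b s] OE ss; first by move: szO; rewrite OE /=; lia.
have [b_odd b_k _] : [/\ odd b, 2 < b <= k & b \notin L].
  by apply: O_gt; rewrite OE !inE eqxx orbT.
move: ss => /= /andP[b3 ss].
have cop3b : coprime 3 b.
  have [b7 | b8] := leqP b 7.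
    by have : (b == 5) || (b == 7) by [lia]; case/orP=> /eqP->.
  have inL x : odd x -> 3 < x < b -> x \in L.
    move=> ox hx; apply: notL => //; first by lia.
    by apply: (sorted_nth_gap O 0 x ltO); rewrite OE.
  have L5 := inL 5 isT (ltn_trans (isT : 5 < 7) b8).
  by move: L57; rewrite L5 (inL 7 isT b8).
have [|||i lt_i|ltw copw wO] := path_weave b s.
- by lia.
- by move: oddO; rewrite OE => /andP[].
- exact: ss.
- by have := gapO i.+1; rewrite OE /= => /(_ lt_i).
exists (b :: weave b s); split.
- by move: szO; rewrite /= size_weave OE /=; lia.
- by rewrite /= b3.
- by rewrite /= cop3b.
- move=> x; rewrite inE OE !inE /= => /predU1P[->|/wO[xs ->]].
    by rewrite eqxx leqnn !orbT.
  by rewrite !orbT; split=> // /xs->; rewrite !orbT.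
- by rewrite /= last_weave; apply: (allP oddO); rewrite OE inE mem_last orbT.
Qed.

(** The multiples of [p] other than [p] and 0 exceed [k]. *)
Lemma coprime_upper_half_prime p x k :
  prime p -> k < p.*2 -> 0 < x <= k -> x != p -> coprime p x.
Proof.
move=> pp kp /andP[x0 xk] xp; rewrite prime_coprime //.
apply/negP => /dvdnP[[|[|q]] xE]; move: x0 xk xp; rewrite xE ?mul1n ?eqxx //.
lia.
Qed.

Lemma has_coprime_labeling_cycle_join_path m n : 2 < m -> (uphalf n).*2 < m ->
  0 < n -> n.-1 <= size (upper_half_primes (uphalf m + n).*2.-1) ->
  has_coprime_labeling (graph_join (cycle_graph m) (path_graph n))
    (uphalf m + n).*2.-1.
Proof.
move=> m2 nm n0 le_n.
set k := (uphalf m + n).*2.-1 in le_n *; pose h := k./2.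
have kE : k = h.*2.+1 by rewrite /h /k; lia.
pose L := take n.-1 (upper_half_primes k).
have szL : size L = n.-1 by rewrite size_take; case: ltngtP le_n.
have uL : uniq L by rewrite take_uniq // filter_uniq ?iota_uniq.
have LP p : p \in L -> [&& prime p, k < p.*2 & p <= k].
  by move/mem_take; rewrite mem_upper_half_primes.
have k5 : 4 < k by rewrite /k; lia.
have Lodd p : p \in L -> odd p && (2 < p <= k).
  by move=> /LP /and3P[/even_prime[->|->]]; lia.
set O := odds_without L h.
have szO : size O = uphalf m.
  by rewrite size_odds_without // ?szL -?kE //; rewrite /h /k; lia.
have O_gt x : x \in O -> [/\ odd x, 2 < x <= k & x \notin L].
  by rewrite mem_odds_without -kE => /and3P.
(* A prime of L exists only if n > 1, and then k is at least 7. *)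
have L3 : 3 \notin L.
  apply/negP => L3; have /and3P[_ lt3 _] := LP _ L3.
  have : 0 < size L by case: (L) L3.
  by rewrite szL; move: lt3; rewrite /k; lia.
(* If 5 and 7 are in L, then n > 2, hence m > 4 and k > 10. *)
have L57 : ~~ ((5 \in L) && (7 \in L)).
  apply/negP => /andP[L5 L7]; have /and3P[_ k10 _] := LP 5 L5.
  have : size [:: 5; 7] <= size L.
    by apply: uniq_leq_size => // x; rewrite !inE => /orP[]/eqP->.
  by rewrite szL /=; move: k10; rewrite /k; lia.
have prL : {in L, forall p, prime p} by move=> p /LP/and3P[].
have [w [szw ltw copw wO last_w]] :=
  exists_cycle_labels _ _ _ m2 prL L3 L57 szO.
have O3 : 3 \in O by rewrite mem_odds_without -kE L3 /=; lia.
have szc : size [:: 2, 3 & w] = m by rewrite /= szw; lia.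
have szt : size (1 :: L) = n by rewrite /= szL prednK.
have cw x : x \in [:: 2, 3 & w] -> 1 < x <= k /\ (odd x -> x \in O).
  rewrite !inE => /or3P[/eqP->|/eqP->|xw]; try by split=> //; lia.
  have [xO /hasP[y /O_gt[_ y_k _] xy]] := wO x xw.
  have x3 : 3 < x := allP (order_path_min ltn_trans ltw) x xw.
  by split=> //; lia.
have tL x : x \in 1 :: L -> 0 < x <= k /\ odd x.
  by rewrite inE => /predU1P[->|/Lodd]; lia.
have disj x : x \in [:: 2, 3 & w] -> x \notin 1 :: L.
  move=> /cw[x1 xO]; apply/negP => xt; have [_ ox] := tL _ xt.
  have [_ _ xL] := O_gt _ (xO ox).
  by move: xt; rewrite inE (negbTE xL) orbF; lia.
rewrite -{1}szc -{1}szt; apply: has_coprime_labeling_join.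
- rewrite cat_uniq; apply/and3P; split.
  + by apply: (sorted_uniq ltn_trans ltnn) => /=.
  + by apply/hasPn => x; apply: contraL => /disj.
  + by rewrite /= uL andbT; apply/negP => /Lodd.
- apply/allP => x; rewrite mem_cat => /orP[/cw[]|/tL[]]; lia.
- rewrite /= rcons_path copw /=.
  by rewrite coprime_sym coprime2n.
- apply: pairwise_sorted; rewrite pairwise_cons; apply/andP; split.
    by apply/allP => p _; apply: coprime1n.
  move: uL; rewrite uniq_pairwise.
  apply: (@sub_in_pairwise _ [in L]); last exact/allP.
  move=> p q /LP/and3P[pp kp _] /LP/and3P[pq _ qk] /= pNq.
  apply: (coprime_upper_half_prime p q k) => //; last by rewrite eq_sym.
  by rewrite prime_gt0.
- apply/allrelP => x p xc; rewrite inE => /predU1P[->|pL].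
    exact: coprimen1.
  have [x1 _] := cw x xc; have /and3P[pp kp pk] := LP p pL.
  rewrite coprime_sym.
  apply: (coprime_upper_half_prime p x k) => //; first by lia.
  by apply/eqP => xp; have := disj x xc; rewrite xp inE pL orbT.
Qed.

(** * The minimum coprime number of the join *)

Local Open Scope ring_scope.

Theorem corollary4p2 (R : realType) (N : nat) (hN : (2 <= N)%N)
  (r : int) (hr : is_ramanujan_prime R (N - 1)%N r)
  (M : int) (hM : r - 2 * N%:Z + 1 <= M)
  (m : nat) (hMm : M <= m%:Z) (hm : (3 <= m)%N)
  (n : nat) (hn1 : (1 <= n)%N) (hnN : (n <= N)%N) :
  min_coprime_number (graph_join (cycle_graph m) (path_graph n)) =
  (if odd m then m + 2 * n else m + 2 * n - 1)%N.
Proof.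
have r_x : r <= ((uphalf m + n).*2.-1 + (N - n).*2)%N%:Z by lia.
have m_big : ((uphalf n).*2 < m)%N.
  have [N3 | N2] := leqP 3 N; last by lia.
  have := ramanujan_bound_gt _ _ _ _ hr.1; lia.
have k1 : (1 < (uphalf m + n).*2.-1)%N by lia.
have primes_k : (n.-1 <= size (upper_half_primes (uphalf m + n).*2.-1))%N.
  have := ramanujan_bound_nat _ _ _ _ hr.1 r_x.
  have := size_upper_half_primesD _ (N - n) k1; lia.
(* The two cases of the formula are one expression in uphalf m. *)
have -> : (if odd m then m + 2 * n else m + 2 * n - 1)%N
    = (uphalf m + n).*2.-1 by case: ifP; lia.
rewrite /min_coprime_number; case: ex_minnP => k k_lab k_min.
apply/eqP; rewrite eqn_leq; apply/andP; split.
  exact/k_min/has_coprime_labeling_cycle_join_path.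
by apply: has_coprime_labeling_lower_bound k_lab => //; lia.
Qed.
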